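(* Let $\mathcal{C}$ be a class of groups with associated invariant length functions, and suppose that, for some fixed $p \in \mathbb{N} \cup \{\infty\}$ (where $\mathbb{N}=\{1,2,3,\ldots\}$), \[(J,\ell_J),(K,\ell_K) \in \mathcal{C} \;\Longrightarrow\; (J \times K,\, L^p_{\ell_J,\ell_K}) \in \mathcal{C}.\] Then the direct product $G \times H$ of any two $\mathcal{C}$-approximable groups $G$ and $H$ is $\mathcal{C}$-approximable.
   Context: An invariant length function on a group $K$ is a map $\ell:K\to[0,1]$ such that for all $x,y\in K$: $\ell(x)=0 \iff x=1$; $\ell(x^{-1})=\ell(x)$; $\ell(xy)\le \ell(x)+\ell(y)$; $\ell(xyx^{-1})=\ell(y)$. A class $\mathcal{C}$ of groups with associated invariant length functions is a collection of pairs $(K,\ell_K)$, where $K$ is a group and $\ell_K$ an invariant length function on $K$ (the same group may occur with several length functions). A weight function for a group $G$ is a map $\delta:G\to\mathbb{R}$, $g\mapsto\delta_g$, with $\delta_1=0$ and $\delta_g>0$ for all $1\neq g\in G$. Given a group $G$ with weight function $\delta$, a group $K$ with invariant length function $\ell_K$, $\epsilon>0$ and a finite subset $F\subseteq G$, a map $\phi:G\to K$ is an $(F,\epsilon,\delta,\ell_K)$-quasi-homomorphism if: $\phi(1)=1$; $\ell_K(\phi(gh)\phi(h)^{-1}\phi(g)^{-1})\le\epsilon$ for all $g,h\in F$; and $\ell_K(\phi(g))\ge\delta_g$ for all $g\in F\setminus\{1\}$. A group $G$ is $\mathcal{C}$-approximable if it has a weight function $\delta$ such that, for each $\epsilon>0$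 and each finite subset $F$ of $G$, there exists an $(F,\epsilon,\delta,\ell_K)$-quasi-homomorphism $\phi:G\to K$ for some $(K,\ell_K)\in\mathcal{C}$. For groups $J,K$ with invariant length functions $\ell_J,\ell_K$, the function $L^p_{\ell_J,\ell_K}:J\times K\to[0,1]$ is defined by \[L^p_{\ell_J,\ell_K}(x,y)=\sqrt[p]{\frac{\ell_J(x)^p+\ell_K(y)^p}{2}}\quad (p\in\mathbb{N}),\qquad L^\infty_{\ell_J,\ell_K}(x,y)=\max(\ell_J(x),\ell_K(y)).\] These are invariant length functions on $J\times K$. *)

(* Defs.v *)
From mathcomp Require Import all_boot all_order all_algebra.
From mathcomp Require Import all_classical all_reals exp.

Set Implicit Arguments.
Unset Strict Implicit.
Unset Printing Implicit Defensive.

Import Order.TTheory GRing.Theory Num.Theory.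
Local Open Scope classical_set_scope.
Local Open Scope ring_scope.

Record invariant_length (R : realType) (K : groupType) (l : K -> R) : Prop := {
  length_itv : forall x, 0 <= l x <= 1;
  length_eq0 : forall x, l x = 0 <-> x = 1%g;
  lengthV : forall x, l x^-1%g = l x;
  lengthM : forall x y, l (x * y)%g <= l x + l y;
  lengthJ : forall x y, l (x * y * x^-1)%g = l y }.

(* [C K l] reads "the pair (K, l) belongs to the class C"; being a predicate
   on pairs, C may contain the same group with several length functions. *)
Definition is_length_class (R : realType)
    (C : forall K : groupType, (K -> R) -> Prop) : Prop :=
  forall (K : groupType) (l : K -> R), C K l -> invariant_length l.

Definition weight_function (R : realType) (G : groupType) (delta : G -> R) :
    Prop :=
  delta 1%g = 0 /\ forall g, g != 1%g -> 0 < delta g.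

Record quasi_homomorphism (R : realType) (G K : groupType) (F : set G)
    (eps : R) (delta : G -> R) (l : K -> R) (phi : G -> K) : Prop := {
  quasi_hom1 : phi 1%g = 1%g;
  quasi_homM : forall g h, F g -> F h ->
    l (phi (g * h) * (phi h)^-1 * (phi g)^-1)%g <= eps;
  quasi_hom_ge : forall g, F g -> g != 1%g -> delta g <= l (phi g) }.

Definition approximable (R : realType)
    (C : forall K : groupType, (K -> R) -> Prop) (G : groupType) : Prop :=
  exists2 delta : G -> R, weight_function delta &
    forall (eps : R) (F : set G), 0 < eps -> finite_set F ->
      exists (K : groupType) (l : K -> R) (phi : G -> K),
        C K l /\ quasi_homomorphism F eps delta l phi.

(* {1, 2, 3, ...} together with infinity *)
Variant exponent := FinExp (n : nat) of (0 < n)%N | InfExp.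

(* The p-th root of a nonnegative real is written as its power p^-1. *)
Definition prod_length (R : realType) (p : exponent) (J K : groupType)
    (lJ : J -> R) (lK : K -> R) : (J * K)%type -> R :=
  match p with
  | FinExp n _ => fun z => ((lJ z.1 ^+ n + lK z.2 ^+ n) / 2) `^ n%:R^-1
  | InfExp => fun z => Num.max (lJ z.1) (lK z.2)
  end.

(* Main.v *)
Require Import Defs.
From mathcomp Require Import all_boot all_order all_algebra.
From mathcomp Require Import all_classical all_reals exp.

Set Implicit Arguments.
Unset Strict Implicit.
Unset Printing Implicit Defensive.

(** Quasi-homomorphisms of the two factors, taken for the two projections of a
    finite set F, combine coordinatewise into a map on G * H, so everything
    reduces to comparing the length of a pair with the lengths of its
    coordinates.  The power mean of two nonnegative numbers lies between half
    their maximum and their maximum, for every exponent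
    ([prod_length_le_max], [half_max_le_prod_length]).  The upper bound keeps
    the defects at most the given epsilon.  The lower bound, which does not
    depend on F or epsilon, shows that half the maximum of the two weights can
    serve as a weight on the product: it is positive as soon as one coordinate
    is nontrivial, which is why the maximum and not the minimum is used. *)

Import Order.TTheory GRing.Theory Num.Theory.
Local Open Scope classical_set_scope.
Local Open Scope ring_scope.

Lemma powR_exprK (R : realType) (n : nat) (x : R) :
  (0 < n)%N -> 0 <= x -> (x ^+ n) `^ n%:R^-1 = x.
Proof.
move=> n_gt0 x_ge0.
by rewrite -powR_mulrn // -powRrM mulfV ?powRr1 // pnatr_eq0 -lt0n.
Qed.

Lemma prod_length_le_max (R : realType) (p : exponent) (J K : groupType)
    (lJ : J -> R) (lK : K -> R) (z : J * K) :
  (forall x, 0 <= lJ x) -> (forall y, 0 <= lK y) ->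
  prod_length p lJ lK z <= Num.max (lJ z.1) (lK z.2).
Proof.
move=> lJ_ge0 lK_ge0; case: p => [n n_gt0|] //=.
set m := Num.max _ _.
have m_ge0 : 0 <= m by rewrite le_max lJ_ge0.
rewrite -[leRHS](powR_exprK n_gt0 m_ge0) ge0_ler_powR ?invr_ge0 ?nnegrE //.
- by rewrite divr_ge0 ?addr_ge0 ?exprn_ge0.
- by rewrite exprn_ge0.
- rewrite ler_pdivrMr // mulr_natr mulr2n.
  by rewrite lerD // lerXn2r ?nnegrE // le_max lexx ?orbT.
Qed.

(** For finite p the sharp constant is the inverse of the p-th root of 2; the
    bound 1/2 holds uniformly because (m / 2) ^ n <= m ^ n / 2 for n >= 1. *)
Lemma half_max_le_prod_length (R : realType) (p : exponent) (J K : groupType)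
    (lJ : J -> R) (lK : K -> R) (z : J * K) :
  (forall x, 0 <= lJ x) -> (forall y, 0 <= lK y) ->
  Num.max (lJ z.1) (lK z.2) / 2 <= prod_length p lJ lK z.
Proof.
move=> lJ_ge0 lK_ge0; case: p => [n n_gt0|] /=; set m := Num.max _ _;
  have m_ge0 : 0 <= m by rewrite le_max lJ_ge0.
- have m2_ge0 : 0 <= m / 2 by rewrite divr_ge0.
  rewrite -[leLHS](powR_exprK n_gt0 m2_ge0) ge0_ler_powR ?invr_ge0 ?nnegrE //.
  + by rewrite exprn_ge0.
  + by rewrite divr_ge0 ?addr_ge0 ?exprn_ge0.
  rewrite expr_div_n ler_pM ?exprn_ge0 ?invr_ge0 ?exprn_ge0 //.
  + rewrite /m; case: (leP (lJ z.1) (lK z.2)) => _.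
      by rewrite lerDr exprn_ge0.
    by rewrite lerDl exprn_ge0.
  + rewrite lef_pV2 ?posrE ?exprn_gt0 //.
    by rewrite ler_eXnr // ler1n.
- by rewrite ler_pdivrMr // ler_peMr // ler1n.
Qed.

(** At the identity the weight vanishes.  This form, valid at every element of
    F, is the one that applies to the coordinates of a nontrivial pair, since
    one of them may be trivial. *)
Lemma quasi_hom_weight_le (R : realType) (G K : groupType) (F : set G) (eps : R)
    (delta : G -> R) (l : K -> R) (phi : G -> K) :
  weight_function delta -> (forall x, 0 <= l x) ->
  quasi_homomorphism F eps delta l phi ->
  forall g, F g -> delta g <= l (phi g).
Proof.
move=> [delta1 _] l_ge0 phi_qh g Fg.
have [->|g_neq1] := eqVneq g 1%g; first by rewrite delta1.
exact: (quasi_hom_ge phi_qh).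
Qed.

Theorem theorem2p1 (R : realType)
    (C : forall K : groupType, (K -> R) -> Prop) (p : exponent)
    (C_length : is_length_class C)
    (C_prod : forall (J K : groupType) (lJ : J -> R) (lK : K -> R),
      C J lJ -> C K lK -> C (J * K)%type (prod_length p lJ lK))
    (G H : groupType) :
  approximable C G -> approximable C H -> approximable C (G * H)%type.
Proof.
move=> [dG wG approxG] [dH wH approxH].
have [dG1 dG_gt0] := wG; have [dH1 dH_gt0] := wH.
exists (fun z => Num.max (dG z.1) (dH z.2) / 2).
  split=> [|[g h] gh_neq1] /=; first by rewrite dG1 dH1 maxxx mul0r.
  rewrite divr_gt0 // lt_max.
  have [g1|/dG_gt0->//] := eqVneq g 1%g.
  have [h1|/dH_gt0->] := eqVneq h 1%g; last by rewrite orbT.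
  by rewrite g1 h1 eqxx in gh_neq1.
move=> eps F eps_gt0 finF.
have [J [lJ [phi [CJ phi_qh]]]] :=
  approxG eps _ eps_gt0 (finite_image fst finF).
have [K [lK [psi [CK psi_qh]]]] :=
  approxH eps _ eps_gt0 (finite_image snd finF).
have lJ_ge0 x : 0 <= lJ x by have /andP[] := length_itv (C_length _ _ CJ) x.
have lK_ge0 y : 0 <= lK y by have /andP[] := length_itv (C_length _ _ CK) y.
exists (J * K)%type, (prod_length p lJ lK), (fun z => (phi z.1, psi z.2)).
split; first exact: C_prod.
split=> [|z w Fz Fw|z Fz _].
- by rewrite /= (quasi_hom1 phi_qh) (quasi_hom1 psi_qh).
- apply: (le_trans (prod_length_le_max _ _ _ _)) => //=.
  rewrite ge_max; apply/andP; split.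
  + by apply: (quasi_homM phi_qh); [exists z | exists w].
  + by apply: (quasi_homM psi_qh); [exists z | exists w].
- apply: le_trans (half_max_le_prod_length _ _ _ _) => //=.
  rewrite ler_pM2r ?invr_gt0 // ge_max !le_max; apply/andP; split.
  + by rewrite (quasi_hom_weight_le wG lJ_ge0 phi_qh) //; exists z.
  + by rewrite (quasi_hom_weight_le wH lK_ge0 psi_qh) ?orbT //; exists z.
Qed.
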